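(* Let $n>k$ be positive integers. Then for every graph $G$ on $n$ vertices, $h_k(G)\ge f_0(n,k)$, where $$f_0(n,k):=\left(\left\lceil \frac{n}{k}\right\rceil-2\right)\binom{k}{2}+\binom{k+1}{2}+\binom{n-k\left(\left\lceil \frac{n}{k}\right\rceil-1\right)-1}{2}.$$
   Context: Graphs are finite, undirected, without loops or multiple edges. For a graph $G$ and a positive integer $k$, $h_k(G)$ denotes the number of unordered pairs of (distinct) vertices of $G$ whose degrees differ by less than $k$, i.e. $|\deg(x)-\deg(y)|<k$. Binomial coefficients satisfy $\binom{m}{2}=m(m-1)/2$ (so $\binom{0}{2}=\binom{1}{2}=0$). *)

(* Defs.v *)
From mathcomp Require Import all_boot all_order all_algebra.

Set Implicit Arguments.
Unset Strict Implicit.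
Unset Printing Implicit Defensive.

(* A graph is a symmetric irreflexive adjacency relation [e] on a finite
   type [V]; symmetry and irreflexivity are left as hypotheses. *)
Definition deg (V : finType) (e : rel V) (x : V) : nat := #|[set y | e x y]|.

(* Unordered pairs are two-element sets [set x; y].  The subtraction under the
   absolute value is the integer one (not truncated). *)
Definition close_pairs (V : finType) (e : rel V) (k : nat) : {set {set V}} :=
  [set [set p.1; p.2] | p : V * V
     & (p.1 != p.2) && (absz (Posz (deg e p.1) - Posz (deg e p.2))%R < k)].

Definition h (V : finType) (e : rel V) (k : nat) : nat := #|close_pairs e k|.

Definition ceil_div (n k : nat) : nat :=
  absz (Num.ceil ((n%:R / k%:R)%R : rat)).

(* For 0 < k < n one has ceil_div n k >= 2 and k * (ceil_div n k - 1) < n, so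
   none of the natural-number subtractions below truncates. *)
Definition f0 (n k : nat) : nat :=
  (ceil_div n k - 2) * 'C(k, 2) + 'C(k.+1, 2)
  + 'C(n - k * (ceil_div n k - 1) - 1, 2).

(* Main.v *)
Require Import Defs.
From mathcomp Require Import all_boot all_order all_algebra.
From mathcomp Require Import zify.

Set Implicit Arguments.
Unset Strict Implicit.
Unset Printing Implicit Defensive.

(** Write [n = C * k + 1 + m] with [m < k], so that [C.+1] is the ceiling of
[n / k] and the bound is the number of pairs inside the parts of a partition of
[n] points into [C - 1] parts of size [k], one of size [k + 1] and one of size
[m].  Call two vertices close if their degrees differ by less than [k], and far
otherwise.

Sorting the degrees [0, ..., n - 1] into blocks of length [k] covers the
vertices by [C.+1] cliques of close vertices.  By convexity this gives a lower
bound for the number of close pairs, but one for parts of nearly equal sizes,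
which is too weak: being a degree sequence has to be used.  It is used once, in
[degree_window].  If [p] vertices have degree at least [C * k] more than [p] other
ones, a comparison of the two degree sums gives [p + C * k < n], that is,
[p <= m].  Hence some window [a, a + C * k) leaves at most [m] vertices below it
and at most [m] above it.

The rest concerns integer labels only and follows Turan's theorem in the form
where a maximal clique of the far graph is removed ([close_in_lower_bound]).
Cutting greedily from the least label upwards, either [C] cliques of close
vertices cover everything, and convexity suffices, or there are [C.+1] pairwise
far vertices, among them one of least and one of greatest label.  Every other
vertex is close to one of these, since a far set has at most one vertex in each
of the [C.+1] blocks.  Removing them takes one vertex from each extremal part
and at least one from each nonempty side of the window, so induction on
[m] applies; for [m = 0] every label lies in a window made of [C] blocks, and
[C.+1] pairwise far vertices do not exist. *)

(** * Graphs: few vertices of extreme degree *)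

(** Compare the degree sums of [A] and [B]: edges between [A] and [B] count
equally on both sides, so the surplus of [B] comes from its neighbours outside
[A], and each vertex of [B] has at most [#|V| - p - 1] of those. *)
Lemma degree_gap_bound (V : finType) (e : rel V) (p D : nat) (A B : {set V})
    (c : nat) :
    symmetric e -> irreflexive e -> [disjoint A & B] ->
    #|A| = p -> #|B| = p -> 0 < p ->
    (forall x, x \in A -> deg e x <= c) ->
    (forall y, y \in B -> c + D <= deg e y) ->
  p + D < #|V|.
Proof.
move=> esym eirr dAB cA cB p_gt0 loA hiB.
have degE x : deg e x = \sum_y e x y.
  rewrite /deg -sum1_card big_mkcond; apply: eq_bigr => y _.
  by rewrite inE; case: (e x y).
have sumA : \sum_(x in A) deg e x <= p * c.
  by rewrite -cA -sum_nat_const; apply: leq_sum => x /loA.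
have sumB : p * (c + D) <= \sum_(y in B) deg e y.
  by rewrite -cB -sum_nat_const; apply: leq_sum => y /hiB.
have inner : \sum_(y in B) \sum_(x in A) e y x <= \sum_(x in A) deg e x.
  rewrite exchange_big; apply: leq_sum => x xA.
  rewrite degE [X in _ <= X](bigID [in B]) /=.
  by under eq_bigr do rewrite esym; rewrite leq_addr.
have outer : \sum_(y in B) \sum_(x | x \notin A) e y x <= p * (#|~: A|).-1.
  rewrite -cB -sum_nat_const; apply: leq_sum => y yB.
  have yA : y \notin A by rewrite (disjointFl dAB yB).
  rewrite (bigD1 y) //= eirr add0n.
  rewrite (cardsD1 y (~: A)) inE yA /= -sum1_card.
  rewrite (eq_bigl [in ~: A :\ y]); last by move=> x; rewrite !inE andbC.
  by apply: leq_sum => x _; case: (e y x).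
have sumB_split : \sum_(y in B) deg e y =
    \sum_(y in B) \sum_(x in A) e y x
    + \sum_(y in B) \sum_(x | x \notin A) e y x.
  by rewrite -big_split; apply: eq_bigr => y _; rewrite degE (bigID [in A]).
have : p * (c + D) <= p * (c + #|~: A|.-1) by rewrite mulnDr; lia.
rewrite leq_pmul2l // leq_add2l => leD.
have : B \subset ~: A by rewrite -disjoints_subset disjoint_sym.
by move/subset_leq_card; have := cardsC A; lia.
Qed.

Lemma degree_lt (V : finType) (e : rel V) (x : V) :
  irreflexive e -> deg e x < #|V|.
Proof.
move=> eirr; rewrite /deg -cardsT; apply: proper_card.
rewrite properEneq subsetT andbT.
by apply/eqP => /setP/(_ x); rewrite !inE eirr.
Qed.

Lemma subset_of_card (T : finType) (A : {set T}) (p : nat) :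
  p <= #|A| -> exists2 B : {set T}, B \subset A & #|B| = p.
Proof.
rewrite -bin_gt0 -cards_draws card_gt0 => /set0Pn[B].
by rewrite inE => /andP[sBA /eqP cB]; exists B.
Qed.

(** Take for [a] the last threshold with few vertices below it.  If there were
also many vertices of degree at least [a + D], equally large sets of vertices of
degree at most [a] and at least [a + D] would contradict [degree_gap_bound]. *)
Lemma degree_window (V : finType) (e : rel V) (D : nat) :
    symmetric e -> irreflexive e -> 0 < D -> D < #|V| ->
  exists a, #|[set x | deg e x < a]| < #|V| - D /\
            #|[set x | a + D <= deg e x]| < #|V| - D.
Proof.
move=> esym eirr D_gt0 D_lt.
pose P a := #|V| - D <= #|[set x | deg e x < a]|.
have exP : exists a, P a.
  exists #|V|; rewrite /P (_ : [set x | _] = setT) ?cardsT ?leq_subr //.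
  by apply/setP => x; rewrite !inE degree_lt.
(* The least threshold with many vertices below it is written [a.+1]. *)
case: (ex_minnP exP) => [[|a] Pa mina].
  by move: Pa; rewrite /P (_ : [set x | _] = set0) ?cards0; [lia | apply/setP].
exists a; split; first by rewrite ltnNge; apply/negP => /mina; rewrite ltnn.
rewrite ltnNge; apply/negP => hiP.
have [A sA cA] := subset_of_card Pa.
have [B sB cB] := subset_of_card hiP.
have loA x : x \in A -> deg e x <= a by move/(subsetP sA); rewrite inE.
have hiB x : x \in B -> a + D <= deg e x by move/(subsetP sB); rewrite inE.
have dAB : [disjoint A & B].
  apply/pred0Pn => -[x /= /andP[/loA xA /hiB xB]]; lia.
have p_gt0 : 0 < #|V| - D by rewrite subn_gt0.
have := degree_gap_bound esym eirr dAB cA cB p_gt0 loA hiB; lia.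
Qed.

(** * Integer labels: close pairs and far sets *)

Lemma bin2S (x : nat) : 'C(x.+1, 2) = 'C(x, 2) + x.
Proof. by rewrite binS bin1 addnC. Qed.

(** The line touches the convex function [x |-> 'C(x, 2)] at [x = K] and
[x = K.+1]; summing it over the parts of a partition bounds the number of pairs
inside the parts, sharply when all parts have size [K] or [K.+1]. *)
Lemma bin2_tangent (K x : nat) : K * x <= 'C(K.+1, 2) + 'C(x, 2).
Proof.
elim: x K => [|x IH] [|K]; rewrite ?muln0 //.
by have := IH K; rewrite !(bin2S K.+1) (bin2S x); lia.
Qed.

Section CloseLabels.

Variables (V : finType) (d : V -> nat) (k : nat).
Hypothesis k_gt0 : 0 < k.

Definition close (x y : V) : bool := (d x < d y + k) && (d y < d x + k).

(** Pairs are encoded as two-element sets all of whose members are mutually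
close (including [x] with itself, as [0 < k]), so that counting them inside a
clique is counting two-element subsets. *)
Definition close_in (S : {set V}) : {set {set V}} :=
  [set P : {set V} | [&& P \subset S, #|P| == 2
                       & [forall x in P, forall y in P, close x y]]].

Definition far_set (X : {set V}) : Prop :=
  {in X &, forall x y, close x y -> x = y}.

Lemma close_sym x y : close x y = close y x.
Proof. exact: andbC. Qed.

Lemma close_in_pair (S : {set V}) (x y : V) :
  ([set x; y] \in close_in S) = [&& x != y, x \in S, y \in S & close x y].
Proof.
rewrite inE cards2 subUset !sub1set.
case: (x =P y) => [|xy] /=; first by rewrite andbF.
rewrite -andbA; congr [&& _, _ & _].
apply/idP/idP => [/forall_inP/(_ x (set21 x y))/forall_inP|cxy].
  by apply; apply: set22.
by do 2!apply/forall_inP => ? /set2P[]->;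
  rewrite ?cxy // 1?close_sym //; rewrite /close; lia.
Qed.

Lemma card_close_in_clique (S : {set V}) :
  {in S &, forall x y, close x y} -> #|close_in S| = 'C(#|S|, 2).
Proof.
move=> clS; rewrite -cards_draws; apply: eq_card => P; rewrite !inE.
case sPS: (P \subset S) => //=; case: eqP => //= _.
apply/forall_inP => x /(subsetP sPS) xS; apply/forall_inP => y /(subsetP sPS).
exact: clS.
Qed.

Lemma close_in_subset (S T : {set V}) :
  S \subset T -> close_in S \subset close_in T.
Proof.
move=> sST; apply/subsetP => P; rewrite !inE => /and3P[sPS -> ->].
by rewrite (subset_trans sPS sST).
Qed.

Lemma card_close_in_split (S A : {set V}) :
  #|close_in (S :&: A)| + #|close_in (S :\: A)| <= #|close_in S|.
Proof.
rewrite -cardsUI (_ : close_in _ :&: _ = set0) ?cards0 ?addn0.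
  by apply: subset_leq_card; rewrite subUset !close_in_subset ?subsetIl ?subsetDl.
apply/setP => P; rewrite !inE; apply/negbTE/negP.
case/andP=> /and3P[/subsetP sI /eqP cP _] /and3P[/subsetP sD _ _].
have [x xP] : exists x, x \in P by apply/set0Pn; rewrite -card_gt0 cP.
by move: (sI x xP) (sD x xP); rewrite !inE => /andP[_ ->] /andP[].
Qed.

(** Labels in the same block of [k] consecutive integers are close. *)
Lemma card_far_window (X : {set V}) (a C : nat) :
    far_set X -> {in X, forall x, a <= d x < a + C * k} -> #|X| <= C.
Proof.
case: C => [|C] farX winX.
  rewrite leqn0 cards_eq0; apply/eqP/setP => x; rewrite inE.
  by apply/negP => /winX; lia.
rewrite -[C.+1]card_ord.
apply: (@leq_card_in _ _ (fun x => inord ((d x - a) %/ k) : 'I_C.+1)) => x y xX yX.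
have q_lt u : u \in X -> (d u - a) %/ k < C.+1.
  by move/winX; rewrite ltn_divLR //; lia.
move/(congr1 val); rewrite /= !inordK ?q_lt //.
move=> eq_q; apply: farX => //; rewrite /close.
have := winX _ xX; have := winX _ yX.
have := divn_eq (d x - a) k; have := divn_eq (d y - a) k.
have := ltn_pmod (d x - a) k_gt0; have := ltn_pmod (d y - a) k_gt0.
rewrite eq_q; lia.
Qed.

(** Greedy choice: the elements with labels below [d x + k] form a clique; remove
it and continue from the least remaining label.  Either [C.+1] cliques exhaust
[S], and [bin2_tangent] is summed over them, or the minima of the first [C.+1]
cliques together with the overall maximum [z] are pairwise far.  Forcing [z]
into the far set is what makes it usable in [close_in_lower_bound]. *)
Lemma cliques_or_far_set (C : nat) (S : {set V}) (x z : V) :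
    x \in S -> z \in S -> {in S, forall y, d x <= d y <= d z} ->
  (forall K, K * #|S| <= C.+1 * 'C(K.+1, 2) + #|close_in S|) \/
  exists X : {set V},
    [/\ X \subset S, x \in X, z \in X, far_set X & #|X| = C.+2].
Proof.
elim: C S x => [|C IH] S x xS zS minmax.
  case: (ltnP (d z) (d x + k)) => [near | apart].
    left=> K; rewrite card_close_in_clique ?mul1n ?bin2_tangent // => y t.
    by move=> /minmax ? /minmax ?; rewrite /close; lia.
  right; exists [set x; z]; split; rewrite ?set21 ?set22 ?subUset ?sub1set ?xS //.
    by move=> ? ? /set2P[]-> /set2P[]->; rewrite /close //; lia.
  by rewrite cards2; case: eqP => // xz; move: apart; rewrite xz; lia.
pose A := [set y | d y < d x + k].
have clA K : K * #|S :&: A| <= 'C(K.+1, 2) + #|close_in (S :&: A)|.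
  rewrite card_close_in_clique ?bin2_tangent // => y t; rewrite !inE.
  by move=> /andP[/minmax ? ?] /andP[/minmax ? ?]; rewrite /close; lia.
have sizeS K : K * #|S| = K * #|S :&: A| + K * #|S :\: A|.
  by rewrite -(cardsID A S) mulnDr.
have [D0 | [y0 y0D]] := set_0Vmem (S :\: A).
  left=> K; have := clA K; have := sizeS K; rewrite D0 cards0.
  have := card_close_in_split S A; lia.
case: (arg_minnP d y0D) => x' x'D x'min.
have zD : z \in S :\: A.
  have := minmax y0; move: y0D; rewrite !inE zS => /andP[? ->] /(_ isT); lia.
have minmax' : {in S :\: A, forall y, d x' <= d y <= d z}.
  move=> y yD; rewrite x'min //=.
  by move: yD; rewrite inE => /andP[_ /minmax/andP[]].
have [tangent|[X [sX x'X zX farX cX]]] := IH (S :\: A) x' x'D zD minmax'.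
  left=> K; move: (tangent K) (clA K) (sizeS K) (card_close_in_split S A).
  by rewrite mulSn; lia.
right; exists (x |: X).
have farx y : y \in X -> d x + k <= d y.
  by move/(subsetP sX); rewrite !inE -leqNgt => /andP[].
split; rewrite ?setU11 //.
- by rewrite subUset sub1set xS (subset_trans sX) ?subsetDl.
- by rewrite setU1r.
- move=> y t /setU1P[->|yX] /setU1P[->|tX] //; rewrite /close.
  + by move: (farx t tX); lia.
  + by move: (farx y yX); lia.
  + exact: farX.
- rewrite cardsU1 cX (_ : x \notin X) //; apply/negP => /farx; lia.
Qed.

(** Labels below [C.+1 * k] leave no room for a far set of size [C.+2], so [X]
is a maximal far set: every [y] outside [X] is close to some member of [X], and
this pair is lost when [X] is removed. *)
Lemma card_close_in_far_set (S X : {set V}) (C : nat) :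
    X \subset S -> far_set X -> #|X| = C.+1 ->
    {in S, forall x, d x < C.+1 * k} ->
  #|close_in (S :\: X)| + #|S :\: X| <= #|close_in S|.
Proof.
move=> sXS farX cX ub.
have dom y : y \in S :\: X -> exists x, (x \in X) && close y x.
  move=> /setDP[yS yX]; apply/existsP; rewrite -[[exists _, _]]negbK negb_exists.
  apply/negP => /forallP noX.
  have nclose x : x \in X -> close y x = false.
    by move=> xX; move: (noX x); rewrite xX; apply: negbTE.
  suff: #|y |: X| <= C.+1 by rewrite cardsU1 yX cX; lia.
  apply: (@card_far_window _ 0); last first.
    by move=> x /setU1P[->|/(subsetP sXS)] => [|xS]; rewrite add0n ub.
  move=> u v /setU1P[->|uX] /setU1P[->|vX] //.
  - by rewrite nclose.
  - by rewrite close_sym nclose.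
  - exact: farX.
pose g y := [set y; odflt y [pick x | (x \in X) && close y x]].
have gP y : y \in S :\: X ->
    exists2 x, g y = [set y; x] & (x \in X) && close y x.
  rewrite /g => /dom [x xP]; case: pickP => [t tP|/(_ x)]; first by exists t.
  by rewrite xP.
have inj : {in S :\: X &, injective g}.
  move=> y y' yD y'D; have [x -> /andP[xX _]] := gP y yD.
  have [x' -> /andP[x'X _]] := gP y' y'D.
  move=> /setP/(_ y); rewrite set21 => /esym/set2P[] // yx'.
  by move: yD; rewrite yx' inE x'X.
rewrite -(card_in_imset inj) -cardsUI (_ : _ :&: _ = set0) ?cards0 ?addn0.
  apply: subset_leq_card; rewrite subUset close_in_subset ?subsetDl //=.
  apply/subsetP => _ /imsetP[y yD ->]; have [x -> /andP[xX cyx]] := gP y yD.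
  move: yD => /setDP[yS yX].
  rewrite close_in_pair yS cyx (subsetP sXS) // !andbT.
  by apply: contraNneq yX => ->.
apply/setP => P; rewrite !inE; apply/negbTE/negP.
case/andP=> /and3P[/subsetP sP _ _] /imsetP[y yD defP].
have [x gy /andP[xX _]] := gP y yD.
have : x \in S :\: X by apply: sP; rewrite defP gy set22.
by rewrite inE xX.
Qed.

(** The bound is the number of pairs inside the parts of a partition of [S] into
[C - 1] parts of size [K], one of size [K + 1] and one of size [m].  Removing
from [S] a far set [X] of size [C + 1] corresponds to removing one element from
each part, and it costs exactly the [#|S :\: X|] close pairs provided by
[card_close_in_far_set].  As [X] contains elements of least and greatest label,
both exceptional sets shrink, so the hypotheses survive with [K] and [m]
lowered by one.  When [m = 0] all labels lie in a window of length [C * k], where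
no such [X] exists.  Without [X], [S] is covered by [C] cliques; convexity then
gives the bound, because the [m <= K] elements of the small part, put into
parts of size about [K], would create at least ['C(m, 2)] pairs. *)
Lemma close_in_lower_bound (m K C a : nat) (S : {set V}) :
    0 < C -> m <= K -> #|S| = C * K + 1 + m ->
    {in S, forall x, d x < C.+1 * k} ->
    #|[set x in S | d x < a]| <= m ->
    #|[set x in S | a + C * k <= d x]| <= m ->
  C * 'C(K, 2) + K + 'C(m, 2) <= #|close_in S|.
Proof.
case: C => // C _.
have bin2sq n : 2 * 'C(n, 2) + n = n * n.
  by elim: n => // n IH; rewrite bin2S; lia.
elim: m K S => [|m IH] K S le_mK cS ub lo hi.
all: have [y0 y0S] : exists y, y \in S by apply/set0Pn; rewrite -card_gt0 cS; lia.
all: case: (arg_minnP d y0S) => x xS xmin.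
all: case: (arg_maxnP d y0S) => z zS zmax.
all: have minmax : {in S, forall y, d x <= d y <= d z}
  by move=> y yS; rewrite (xmin y yS); apply: zmax.
all: have [tangent|[X [sXS xX zX farX cX]]] := cliques_or_far_set C xS zS minmax.
- move: (tangent K); rewrite cS (bin2S K) (_ : 'C(0, 2) = 0) //.
  have -> : K * (C.+1 * K + 1 + 0) = C.+1 * (K * K) + K by lia.
  by rewrite -(bin2sq K) !mulnDr; lia.
- have : #|X| <= C.+1; last by rewrite cX ltnn.
  apply: (@card_far_window _ a) => // y /(subsetP sXS) yS.
  move: lo hi; rewrite !leqn0 !cards_eq0 => /eqP/setP/(_ y) + /eqP/setP/(_ y).
  by rewrite !inE yS /=; lia.
- have le_bin : 'C(m.+1, 2) <= K * m.+1.
    have : m.+1 * m.+1 <= K * m.+1 by rewrite leq_mul2r le_mK orbT.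
    by move: (bin2sq m.+1); lia.
  move: (tangent K) le_bin; rewrite cS (bin2S K).
  have -> : K * (C.+1 * K + 1 + m.+1) = C.+1 * (K * K) + K + K * m.+1 by lia.
  by rewrite -(bin2sq K) !mulnDr; lia.
case: K le_mK cS => // K le_mK cS.
have drop := card_close_in_far_set sXS farX cX ub.
have cD : #|S :\: X| = C.+1 * K + 1 + m.
  by rewrite cardsD (setIidPr sXS) cS cX; lia.
have shrink (Q : pred V) t : t \in X -> (forall y, y \in S -> Q y -> Q t) ->
    #|[set y in S | Q y]| <= m.+1 -> #|[set y in S :\: X | Q y]| <= m.
  move=> tX Qt le_m.
  have [->|[y]] := set_0Vmem [set y in S :\: X | Q y]; first by rewrite cards0.
  rewrite !inE -andbA => /and3P[_ yS Qy].
  have tQ : t \in [set y in S | Q y] by rewrite inE (subsetP sXS) //= (Qt y).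
  rewrite -ltnS; apply: leq_trans le_m; apply: proper_card; apply/properP.
  split; last by exists t => //; rewrite !inE tX.
  by apply/subsetP => u; rewrite !inE -andbA => /and3P[_ -> ->].
have := IH K (S :\: X) le_mK cD.
have ubD : {in S :\: X, forall y, d y < C.+2 * k} by move=> y /setDP[/ub].
have loD := shrink (fun y => d y < a) x xX.
have hiD := shrink (fun y => a + C.+1 * k <= d y) z zX.
move=> /(_ ubD) rec.
have {}rec : C.+1 * 'C(K, 2) + K + 'C(m, 2) <= #|close_in (S :\: X)|.
  apply: rec.
    by apply: loD lo => y /minmax; lia.
  by apply: hiD hi => y /minmax; lia.
by move: drop rec; rewrite cD !bin2S; lia.
Qed.

End CloseLabels.

(** * The bound *)

Lemma ceil_divP (n k q : nat) :
  0 < k -> q * k < n <= q.+1 * k -> ceil_div n k = q.+1.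
Proof.
move=> k_gt0 /andP[lo hi]; rewrite /ceil_div.
rewrite (@Num.Theory.ceil_def _ _ (Posz q.+1)) //.
have k0 : (0 < k%:R :> rat)%R by rewrite Num.Theory.ltr0n.
rewrite (_ : (Posz q.+1 - 1)%R = Posz q); last by lia.
rewrite -!pmulrn.
rewrite Num.Theory.ltr_pdivlMr // Num.Theory.ler_pdivrMr //.
by rewrite -!GRing.natrM Num.Theory.ltr_nat Num.Theory.ler_nat lo.
Qed.

Lemma close_pairsE (V : finType) (e : rel V) (k : nat) :
  0 < k -> close_pairs e k = close_in (deg e) k setT.
Proof.
move=> k_gt0; apply/setP => P.
have absE x y :
    (absz (Posz (deg e x) - Posz (deg e y))%R < k) = close (deg e) k x y.
  by rewrite /close; lia.
apply/imsetP/idP => [[[x y] /=] | PP].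
  by rewrite inE /= absE => xy ->; rewrite close_in_pair // !inE.
have /cards2P[x [y [xy defP]]] : #|P| == 2 by move: PP; rewrite inE => /and3P[].
move: PP; rewrite defP close_in_pair // !inE => /= /andP[_ cxy].
by exists (x, y); rewrite // inE /= absE xy.
Qed.

Theorem theorem2 (n k : nat) (k_gt0 : 0 < k) (k_lt_n : k < n)
    (V : finType) (e : rel V) (e_sym : symmetric e) (e_irr : irreflexive e)
    (V_card : #|V| = n) :
  f0 n k <= h e k.
Proof.
pose C := n.-1 %/ k; pose m := n.-1 %% k.
have nE : n = C * k + 1 + m by have := divn_eq n.-1 k; rewrite -/C -/m; lia.
have m_lt : m < k by rewrite ltn_mod.
have C_gt0 : 0 < C by rewrite divn_gt0 //; lia.
have ceilE : ceil_div n k = C.+1 by apply: ceil_divP; rewrite // nE mulSn; lia.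
have [||a [lo hi]] := @degree_window V e (C * k) e_sym e_irr.
- by rewrite muln_gt0 C_gt0.
- by rewrite V_card nE; lia.
have -> : f0 n k = C * 'C(k, 2) + k + 'C(m, 2).
  rewrite /f0 ceilE bin2S -addnA -[C in RHS](ltn_predK C_gt0) mulSn.
  rewrite (_ : n - _ - _ = m); last by rewrite nE subn1 /= mulnC; lia.
  by rewrite (_ : C.+1 - 2 = C.-1); lia.
have setE (Q : pred V) : [set x in [set: V] | Q x] = [set x | Q x].
  by apply/setP => x; rewrite !inE.
rewrite /h close_pairsE //; apply: (@close_in_lower_bound _ _ k _ m k C a) => //.
- exact: ltnW.
- by rewrite cardsT V_card.
- move=> x _; apply: leq_trans (degree_lt x e_irr) _.
  by rewrite V_card nE mulSn; lia.
- by move: lo; rewrite V_card {1}nE setE; lia.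
- by move: hi; rewrite V_card {1}nE setE; lia.
Qed.
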